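(* Let $(p_1, \ldots, p_m)$ be an $m$-tuple of real polynomials in $t \in \mathbf{R}^n$, and let $$\theta(t) = (1 + t_1^2 + \cdots + t_n^2)^{-1}, \quad t \in \mathbf{R}^n.$$ Let $g_1(t)$, $g_0(t)$ be real polynomials with $\deg(g_0) < \deg(g_1)$, such that the homogeneous polynomial $G_1$ attached to $g_1$ (its homogenization) satisfies $G_1(x) > 0$ for all $x \in \mathbf{R}^{n+1} \setminus \{0\}$. Let $p = g_0 + g_1$. Assume that $p(t) > 0$ whenever $t \in \bigcap_{k=1}^m p_k^{-1}(\mathbf{R}_+)$. Then there exist an integer $b \geq 0$ and a finite collection of real polynomials $\{q_\ell, q_{k\ell}\}$, $\ell \in L$, $k = 1, \ldots, m$, such that $$p(t) = \theta(t)^{2b}\left(\sum_{\ell \in L} q_\ell(t)^2 + \sum_{k=1}^m \sum_{\ell \in L} p_k(t) q_{k\ell}(t)^2\right), \quad t \in \mathbf{R}^n.$$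
   Context: $n \ge 1$ is a fixed integer; $\mathbf{R}_+ = [0,\infty)$. The homogenization of a polynomial $g$ in $t \in \mathbf{R}^n$ with $\deg(g) = d$ is the homogeneous polynomial $G$ of degree $d$ in $x = (x_0, x_1, \ldots, x_n) \in \mathbf{R}^{n+1}$ determined by $G(x_0, x_1, \ldots, x_n) = x_0^d\, g\!\left(\frac{x_1}{x_0}, \ldots, \frac{x_n}{x_0}\right)$ for $x_0 \neq 0$. *)

(* Defs.v *)
From mathcomp Require Import all_boot all_order all_algebra.
From mathcomp Require Import reals.
From mathcomp Require Import mpoly.

Set Implicit Arguments.
Unset Strict Implicit.
Unset Printing Implicit Defensive.

Import Order.TTheory GRing.Theory Num.Theory.
Local Open Scope ring_scope.

(* [msize g] is deg g + 1 for nonzero g, and [msize 0 = 0], so the degree used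
   here is [(msize g).-1]; the variable x_0 is indexed by [ord0]. *)
Definition is_homogenization (R : fieldType) (n : nat)
    (g : {mpoly R[n]}) (G : {mpoly R[n.+1]}) : Prop :=
  G \is (msize g).-1.-homog /\
  forall x : 'rV[R]_n.+1, x 0 ord0 != 0 ->
    G.@[x 0] = x 0 ord0 ^+ (msize g).-1 *
               g.@[fun i => x 0 (lift ord0 i) / x 0 ord0].

Definition theta (R : fieldType) (n : nat) (t : 'rV[R]_n) : R :=
  (1 + \sum_(i < n) t 0 i ^+ 2)^-1.

Lemma is_homogenization_exists (R : fieldType) (n : nat) (g : {mpoly R[n]}) :
  exists G, is_homogenization g G.
Proof.
set d := (msize g).-1.
pose mh (m : 'X_{1..n}) : 'X_{1..n.+1} :=
  [multinom oapp m (d - mdeg m)%N (unlift ord0 i) | i < n.+1].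
have mh0 m : mh m ord0 = (d - mdeg m)%N by rewrite mnmE unlift_none.
have mhS m i : mh m (lift ord0 i) = m i by rewrite mnmE liftK.
have led m : m \in msupp g -> (mdeg m <= d)%N.
  by move=> /msize_mdeg_lt; rewrite /d; case: (msize g).
exists (\sum_(m <- msupp g) g@_m *: 'X_[mh m]); split.
  rewrite big_seq; apply: rpred_sum => m /led mg; apply: rpredZ.
  rewrite dhomogX; apply/eqP; rewrite [LHS]mdegE big_ord_recl mh0.
  under eq_bigr do rewrite mhS.
  by rewrite -mdegE subnK.
move=> x x0; rewrite [in RHS]mevalE.
rewrite raddf_sum /= mulr_sumr big_seq [RHS]big_seq.
apply: eq_bigr => m /led mg.
rewrite mevalZ mevalX big_ord_recl mh0 [RHS]mulrCA.
congr (_ * _).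
rewrite (eq_bigr (fun i => x 0 (lift ord0 i) ^+ m i)) => [|i _]; last first.
  by rewrite mhS.
rewrite [in RHS](eq_bigr _ (fun i _ => expr_div_n _ _ _)).
rewrite prodf_div prodrXr -mdegE mulrCA [LHS]mulrC.
congr (_ * _).
by rewrite -expfB_cond // (negPf x0) add0n.
Qed.

Lemma poly_horner_eq0 (R : numFieldType) (p : {poly R}) :
  (forall x, p.[x] = 0) -> p = 0.
Proof.
move=> p0; apply/eqP; apply: contraT => pn0.
have := @max_poly_roots _ p [seq i%:R | i <- iota 0 (size p)] pn0.
rewrite size_map size_iota ltnn; apply.
  by apply/allP => x _; apply/rootP.
by rewrite map_inj_uniq ?iota_uniq // => i j /eqP; rewrite eqr_nat => /eqP.
Qed.

Lemma meval_eq0 (R : numFieldType) (n : nat) (p : {mpoly R[n]}) :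
  (forall x : 'I_n -> R, p.@[x] = 0) -> p = 0.
Proof.
elim: n p => [|n IH] p p0.
  have := p0 (fun=> 0).
  by rewrite (nvar0_mpolyC p) mevalC => ->; rewrite mpolyC0.
pose w (i : 'I_n) : 'I_n.+1 := widen_ord (leqnSn n) i.
pose r (m : 'X_{1..n.+1}) : 'X_{1..n} := [multinom m (w i) | i < n].
have ev (x : 'I_n.+1 -> R) :
    (map_poly (meval (x \o w)) (muni p)).[x ord_max] = p.@[x].
  rewrite muniE [RHS]mevalE !raddf_sum horner_sum; apply: eq_bigr => m _ /=.
  rewrite map_polyZ map_polyXn hornerZ hornerXn /= mevalZ mevalX.
  rewrite big_ord_recr /= mulrA; congr (_ * _ * _).
  by apply: eq_bigr => i _; rewrite mnmE.
have u0 : muni p = 0.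
  apply/polyP => k; rewrite coef0; apply: IH => x.
  have : map_poly (meval x) (muni p) = 0.
    apply: poly_horner_eq0 => y.
    pose z (i : 'I_n.+1) := oapp x y (unlift ord_max i).
    have zmax : z ord_max = y by rewrite /z unlift_none.
    have zw i : z (w i) = x i.
      rewrite /z; have -> : w i = lift ord_max i.
        by apply: val_inj; rewrite /= /bump leqNgt ltn_ord.
      by rewrite liftK.
    rewrite -(p0 z) -ev zmax; congr (_.[_]).
    by apply: eq_map_poly => q; apply: meval_eq => i; rewrite /= zw.
  by move/polyP/(_ k); rewrite coef_map coef0.
apply/mpolyP => m; rewrite mcoeff0.
have := congr1 (fun q : {poly {mpoly R[n]}} => q`_(m ord_max)@_(r m)) u0.
rewrite coef0 mcoeff0 muniE coef_sum raddf_sum /= => <-.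
rewrite {1}[p]mpolyE raddf_sum /=; apply: eq_bigr => m' _.
rewrite coefZ coefXn mcoeffZ mcoeffX.
rewrite mulr_natr mcoeffMn mcoeffZ mcoeffX -mulrnAr -mulrnA mulnb.
congr (_ * (nat_of_bool _)%:R); apply/eqP/andP => [->|[/eqP rE /eqP mE]].
  by split; apply/eqP.
apply/mnmP => i; have [j ->|->] := unliftP ord_max i; last by rewrite mE.
have -> : lift ord_max j = w j.
  by apply: val_inj; rewrite /= /bump leqNgt ltn_ord.
by have /mnmP/(_ j) := rE; rewrite !mnmE.
Qed.

Lemma is_homogenization_uniq (R : numFieldType) (n : nat) (g : {mpoly R[n]})
    (G G' : {mpoly R[n.+1]}) :
  is_homogenization g G -> is_homogenization g G' -> G = G'.
Proof.
move=> [_ GE] [_ GE']; apply/eqP; rewrite -subr_eq0.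
have X0 : 'X_ord0 != 0 :> {mpoly R[n.+1]}.
  by apply/eqP => /mpolyP/(_ U_(ord0)%MM)/eqP; rewrite mcoeffX eqxx mcoeff0 oner_eq0.
have /eqP : (G - G') * 'X_ord0 = 0.
  apply: meval_eq0 => x; rewrite mevalM mevalB mevalXU.
  have [->|x0] := eqVneq (x ord0) 0; first by rewrite mulr0.
  have xE : (\row_i x i) 0 =1 x by move=> i; rewrite mxE.
  have {}x0 : (\row_i x i) 0 ord0 != 0 by rewrite xE.
  by rewrite -!(meval_eq _ xE) GE // GE' // subrr mul0r.
by rewrite mulf_eq0 (negPf X0) orbF.
Qed.

(* Main.v *)
(** The map t |-> s (1, t) with s^2 = theta t identifies R^n with the part
    x_0 <> 0 of the unit sphere modulo the antipodal map.  The homogenization P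
    of p is positive on the part of the sphere where suitable even-degree
    multiples x_0^j P_k of the homogenizations of the p_k are nonnegative: for
    x_0 <> 0 by the hypothesis on p, for x_0 = 0 because there P agrees with G_1.
    The sphere makes the relevant quadratic module archimedean, so Putinar's
    theorem puts P in it; averaging the resulting identity over antipodal points
    removes the odd powers of s and leaves powers of theta.

    Putinar's theorem is obtained from a maximal proper quadratic module M: it
    is total (each a or -a lies in M), and its order defines a "standard part"
    a |-> c (a - c infinitesimal), which is a ring morphism to R. *)

Require Import Defs.
From mathcomp Require Import all_boot all_order all_algebra.
From mathcomp Require Import reals.
From mathcomp Require Import mpoly.
From HB Require Import structures.
From mathcomp Require Import boolp classical_sets.
From mathcomp Require Import ring lra.
Import Order.TTheory GRing.Theory Num.Theory.
Local Open Scope ring_scope.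

(** * Archimedean quadratic modules *)

Section QuadraticModules.
Variables (R : realType) (A : comNzRingType) (iota : {rmorphism R -> A}).
Implicit Types (M : set A) (a b : A) (s : seq A) (c d e r : R).

Definition quadratic_module M : Prop :=
  [/\ M 1, forall a b, M a -> M b -> M (a + b) & forall a b, M b -> M (a ^+ 2 * b)].

(** Upper bounds are enough: applied to [- a], they give lower bounds. *)
Definition archimedean_module M : Prop := forall a, exists r, M (iota r - a).

Definition sumsq (s : seq A) : A := \sum_(a <- s) a ^+ 2.

Definition adjoin M a : set A :=
  [set x | exists b s, M b /\ x = b + a * sumsq s]%classic.

Section Closure.
Variables (M : set A) (qM : quadratic_module M).

Lemma qm1 : M 1. Proof. by case: qM. Qed.
Lemma qmD a b : M a -> M b -> M (a + b). Proof. by case: qM => _ + _; apply. Qed.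
Lemma qmM2 a b : M b -> M (a ^+ 2 * b). Proof. by case: qM => _ _; apply. Qed.

Lemma qmX2 a : M (a ^+ 2).
Proof. by rewrite -[X in M X]mulr1; apply/qmM2/qm1. Qed.

Lemma qm0 : M 0.
Proof. by have := qmX2 0; rewrite expr0n. Qed.

Lemma qmZ c a : 0 <= c -> M a -> M (iota c * a).
Proof. by move=> c0 Ma; rewrite -(sqr_sqrtr c0) rmorphXn; apply: qmM2. Qed.

Lemma qmZI c a : 0 < c -> M (iota c * a) -> M a.
Proof.
move=> c0 Ma; have := qmZ (c^-1) _ _ Ma.
by rewrite mulrA -rmorphM mulVf ?gt_eqF // rmorph1 mul1r invr_ge0 ltW //; apply.
Qed.

Lemma qmC c : 0 <= c -> M (iota c).
Proof. by move=> c0; rewrite -[X in M X]mulr1; apply/qmZ/qm1. Qed.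

Lemma qm_sumsqM s b : M b -> M (sumsq s * b).
Proof.
move=> Mb; rewrite /sumsq mulr_suml.
by elim/big_ind: _ => [|a a' Ma Ma'|a _]; [exact: qm0|exact: qmD|exact: qmM2].
Qed.

Lemma qm_sumsq s : M (sumsq s).
Proof. by rewrite -[X in M X]mulr1; apply/qm_sumsqM/qm1. Qed.

(** Polarization, [4 b = (b + 1)^2 - (b - 1)^2], makes the set of all [a] with both [a] and [- a] in
    [M] an ideal. *)
Lemma qm_supportM a b : M a -> M (- a) -> M (b * a).
Proof.
move=> Ma MNa; apply: (qmZI 4); first by rewrite ltr0n.
have -> : iota 4 * (b * a) = (b + 1) ^+ 2 * a + (b - 1) ^+ 2 * - a by ring.
by apply: qmD; apply: qmM2.
Qed.

Lemma qm_negC c : 0 < c -> M (- iota c) -> M (- 1).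
Proof. by move=> c0 Mc; apply: (qmZI c) => //; rewrite mulrN1. Qed.

Lemma qm_adjoin a : quadratic_module (adjoin M a).
Proof.
split=> [|_ _ [b [s [Mb ->]]] [b' [s' [Mb' ->]]]|x _ [b [s [Mb ->]]]].
- by exists 1, [::]; split; [exact: qm1|rewrite /sumsq big_nil mulr0 addr0].
- exists (b + b'), (s ++ s'); split; first exact: qmD.
  by rewrite /sumsq big_cat /=; ring.
- exists (x ^+ 2 * b), [seq x * y | y <- s]; split; first exact: qmM2.
  rewrite /sumsq big_map mulrDr mulrCA mulr_sumr; congr (_ + _ * _).
  by apply: eq_bigr => y _; rewrite exprMn.
Qed.

Lemma sub_adjoin a : (M `<=` adjoin M a)%classic.
Proof. by move=> b Mb; exists b, [::]; rewrite /sumsq big_nil mulr0 addr0. Qed.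

Lemma mem_adjoin a : adjoin M a a.
Proof. by exists 0, [:: 1]; split; [exact: qm0|rewrite /sumsq big_seq1; ring]. Qed.

(* Once [M (f + r)] holds for some [r >= 0], the certificate for [-1] lets
   [r] be decreased by the fixed amount [1 / k ^ 2], whence [M f]. *)
Lemma qm_of_adjoin_opp f :
  archimedean_module M -> adjoin M (- f) (- 1) -> M f.
Proof.
move=> arch [b [s [Mb eN1]]]; set g := sumsq s in eN1.
have Mg : M g := qm_sumsq s.
have Mgf : M (g * f - 1) by rewrite (_ : _ - _ = b) //; rewrite eN1; ring.
have [r1 M1] := arch (g ^+ 2 * f); have [r2 M2] := arch g.
(* Large enough that [r1 <= 2 k - 1] and [r2 <= 2 k], so a single constant controls both
   [g ^+ 2 * f] and [g]. *)
pose k := 1 + `|r1| + `|r2|.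
have [n1 n2 k1] : [/\ r1 <= `|r1|, r2 <= `|r2| & 1 <= k].
  by rewrite !ler_norm /k -addrA lerDl addr_ge0.
have k0 : 0 < k by lra.
have {}M1 : M (iota (2 * k - 1) - g ^+ 2 * f).
  have -> : iota (2 * k - 1) - g ^+ 2 * f
    = iota (2 * k - 1 - r1) + (iota r1 - g ^+ 2 * f) by ring.
  by apply: qmD => //; apply: qmC; rewrite /k; have := normr_ge0 r1;
     have := normr_ge0 r2; lra.
have {}M2 : M (iota (2 * k) - g).
  have -> : iota (2 * k) - g = iota (2 * k - r2) + (iota r2 - g) by ring.
  by apply: qmD => //; apply: qmC; rewrite /k; have := normr_ge0 r1;
     have := normr_ge0 r2; lra.
have {}M2 : M (g * (iota (2 * k) - g)).
  apply: (qmZI (2 * k)); first lra.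
  have -> : iota (2 * k) * (g * (iota (2 * k) - g)) =
    (iota (2 * k) - g) ^+ 2 * g + g ^+ 2 * (iota (2 * k) - g) by ring.
  by apply: qmD; apply: qmM2.
have step r : 0 <= r -> M (f + iota r) -> M (f + iota (r - k ^- 2)).
  move=> r0 Mr; apply: (qmZI (k ^+ 2)); first by rewrite exprn_gt0.
  (* In [(k - g)^2 (f + r)] the cross term [- 2 k g f] is cancelled through [g f - 1], the term
     [g^2 f] through its bound, and the terms in [r g] through [g (2 k - g)]. The constants left
     over, [- 2 k + (2 k - 1)], are the gain of [-1]. *)
  have -> : iota (k ^+ 2) * (f + iota (r - k ^- 2)) =
      (iota k - g) ^+ 2 * (f + iota r) + iota (2 * k) * (g * f - 1)
      + (iota (2 * k - 1) - g ^+ 2 * f) + iota r * (g * (iota (2 * k) - g)).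
    rewrite mulrDr -rmorphM mulrBr divff; last by rewrite expf_neq0 ?gt_eqF.
    by ring.
  apply: qmD; last exact: qmZ.
  apply: qmD => //; apply: qmD; first exact: qmM2.
  by apply: qmZ => //; lra.
have [r Mr] := arch (- f); rewrite opprK addrC in Mr.
have k20 : 0 < k ^- 2 by rewrite invr_gt0 exprn_gt0.
have [N] : exists N : nat, r <= N%:R * k ^- 2.
  exists (Num.truncn (`|r| * k ^+ 2)).+1.
  rewrite -ler_pdivrMr // invrK ltW //.
  by apply: le_lt_trans (truncnS_gt _); rewrite ler_wpM2r ?exprn_ge0 ?ler_norm // ltW.
elim: N r Mr => [|N IH] r Mr hr.
  have -> : f = (f + iota r) + iota (- r) by ring.
  by apply: qmD => //; apply: qmC; rewrite mul0r in hr; lra.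
have [r0|r0] := leP 0 r; last first.
  have -> : f = (f + iota r) + iota (- r) by ring.
  by apply: qmD => //; apply: qmC; lra.
by apply: (IH (r - k ^- 2)) (step _ _ _) _ => //; rewrite -natr1 in hr; lra.
Qed.

End Closure.

(** * Maximal proper quadratic modules *)

Lemma maximal_quadratic_module M : quadratic_module M -> ~ M (- 1) ->
  exists M', [/\ quadratic_module M', (M `<=` M')%classic, ~ M' (- 1) &
    forall N, quadratic_module N -> (M' `<=` N)%classic -> ~ N (- 1) ->
      (N `<=` M')%classic].
Proof.
move=> qM M1.
pose proper N := [/\ quadratic_module N, (M `<=` N)%classic & ~ N (- 1)].
(* Zorn_bigcup ranges over all chains, the empty one included. *)
pose P (N : set A) := N = set0 \/ proper N.
have [F FP totF|N [PN maxN]] := @Zorn_bigcup A P.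
  have [[N FN pN]|F0] := pselect (exists2 N, F N & proper N); last first.
    left; apply/seteqP; split=> // a [N FN Na].
    by have [N0|pN] := FP _ FN; [rewrite N0 in Na|case: F0; exists N].
  have pF N' a : F N' -> N' a -> proper N'.
    by move=> FN' N'a; have [N0|] := FP _ FN'; first by rewrite N0 in N'a.
  have [qN MN N1] := pN; right; split.
  - split=> [|a b [N1' F1 Na] [N2 F2 Nb]|a b [N' F' Nb]].
    + by exists N => //; apply: qm1.
    + have [q1 _ _] := pF _ _ F1 Na; have [q2 _ _] := pF _ _ F2 Nb.
      have [s12|s21] := totF _ _ F1 F2; [exists N2|exists N1'] => //.
        by apply: qmD => //; apply: s12.
      by apply: qmD => //; apply: s21.
    + by have [q' _ _] := pF _ _ F' Nb; exists N' => //; apply: qmM2.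
  - by move=> a Ma; exists N => //; apply: MN.
  - by move=> [N' F' N'1]; have [_ _] := pF _ _ F' N'1; apply.
case: PN => [N0|[qN MN N1]]; last first.
  exists N; split=> // N' qN' NN' N'1 a N'a; apply: contrapT => Na.
  have NN'lt : (N `<` N')%classic by split=> // /(_ _ N'a).
  by apply: (maxN _ NN'lt); right; split=> // x /MN /NN'.
(* The empty set satisfies [P] but cannot be maximal, since [M] lies strictly above it. *)
have lt0M : (N `<` M)%classic.
  rewrite N0; split; first by move=> x.
  by move=> /(_ 1 (qm1 _ qM)).
by exfalso; apply: (maxN _ lt0M); right; split.
Qed.

Section Maximal.
Variables (M : set A) (qM : quadratic_module M) (M1 : ~ M (- 1)).
Hypothesis maxM : forall N, quadratic_module N -> (M `<=` N)%classic ->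
  ~ N (- 1) -> (N `<=` M)%classic.

(** If neither holds, maximality gives [-1 = b + a g] and [-1 = b' - a g'] with sums of squares [g],
    [g']. Eliminating [a g g'] shows [- g] in [M]; then [a g] is in [M] because [g] and [- g] are,
    and the first identity puts [-1] in [M]. *)
Lemma maximal_total a : M a \/ M (- a).
Proof.
have adj b : ~ M b -> adjoin M b (- 1).
  move=> Mb; apply: contrapT => b1; apply: Mb.
  exact: (maxM _ (qm_adjoin _ qM b) (sub_adjoin _ b) b1) _ (mem_adjoin _ qM b).
have [Ma|Ma] := pselect (M a); first by left.
have [MNa|MNa] := pselect (M (- a)); first by right.
have [b [s [Mb e1]]] := adj _ Ma; have [b' [s' [Mb' e2]]] := adj _ MNa.
set g := sumsq s in e1; set g' := sumsq s' in e2.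
have Mg : M g := qm_sumsq _ qM s; have Mg' : M g' := qm_sumsq _ qM s'.
have MNg : M (- g).
  have -> : - g = g' + g' * b + g * b'.
    have -> : - g = g * - 1 by ring.
    rewrite {1}e2; have : g' * - 1 = g' * (b + a * g) by rewrite -e1.
    move=> e3; transitivity (g * b' - g' * a * g); first by ring.
    have -> : g' * a * g = g' * - 1 - g' * b by rewrite e3; ring.
    by ring.
    by apply: qmD; [|apply: qmD|] => //; apply: qm_sumsqM.
by case: M1; rewrite e1; apply: qmD => //; apply: qm_supportM.
Qed.

(** * The standard part as a ring morphism *)

Definition standard_part a c : Prop :=
  forall e, 0 < e -> M (a - iota c + iota e) /\ M (iota c - a + iota e).

Lemma standard_partC c : standard_part (iota c) c.
Proof. by move=> e e0; rewrite subrr add0r; split; apply: qmC => //; apply: ltW. Qed.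

Lemma standard_partD a b c d :
  standard_part a c -> standard_part b d -> standard_part (a + b) (c + d).
Proof.
move=> ac bd e e0; have e2 : 0 < e / 2 by lra.
have [ac1 ac2] := ac _ e2; have [bd1 bd2] := bd _ e2.
have ee : iota e = iota (e / 2) + iota (e / 2) by rewrite -rmorphD -splitr.
split.
  have -> : a + b - iota (c + d) + iota e
    = (a - iota c + iota (e / 2)) + (b - iota d + iota (e / 2)) by rewrite ee; ring.
  exact: qmD.
have -> : iota (c + d) - (a + b) + iota e
  = (iota c - a + iota (e / 2)) + (iota d - b + iota (e / 2)) by rewrite ee; ring.
exact: qmD.
Qed.

Lemma standard_partN a c : standard_part a c -> standard_part (- a) (- c).
Proof.
move=> ac e e0; have [ac1 ac2] := ac _ e0.
split.
  by have -> : - a - iota (- c) + iota e = iota c - a + iota e by ring.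
by have -> : iota (- c) - - a + iota e = a - iota c + iota e by ring.
Qed.

Lemma standard_partZ k a c : standard_part a c -> standard_part (iota k * a) (k * c).
Proof.
wlog k0 : k a c / 0 < k => [hw ac|].
  have [k0|k0|->] := ltrgtP k 0; last 2 first.
  - exact: hw.
  - by rewrite rmorph0 !mul0r; have := standard_partC 0; rewrite rmorph0.
  have := hw (- k) (- a) (- c); rewrite oppr_gt0 rmorphN !mulrNN; apply=> //.
  exact: standard_partN.
move=> ac e e0; have [|ac1 ac2] := ac (e / k); first exact: divr_gt0.
have ee : iota e = iota k * iota (e / k) by rewrite -rmorphM mulrCA divff ?gt_eqF ?mulr1.
split.
  have -> : iota k * a - iota (k * c) + iota e = iota k * (a - iota c + iota (e / k)).
    by rewrite ee; ring.
  by apply: qmZ => //; apply: ltW.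
have -> : iota (k * c) - iota k * a + iota e = iota k * (iota c - a + iota (e / k)).
  by rewrite ee; ring.
by apply: qmZ => //; apply: ltW.
Qed.

Lemma standard_part_ge0 a c : M a -> standard_part a c -> 0 <= c.
Proof.
move=> Ma ac; rewrite leNgt; apply/negP => c0; apply: M1.
(* At the tolerance [- c / 2] the sum below collapses to [c / 2], a negative constant in [M]. *)
have [|_ h] := ac (- c / 2); first by lra.
apply: (qm_negC _ qM (- c / 2)); first by lra.
have -> : - iota (- c / 2) = a + (iota c - a + iota (- c / 2)).
  by rewrite -rmorphN (_ : - (- c / 2) = c + - c / 2); [ring|lra].
exact: qmD.
Qed.

Lemma standard_part_uniq a c d : standard_part a c -> standard_part a d -> c = d.
Proof.
have le (a' : A) c' d' : standard_part a' c' -> standard_part a' d' -> c' <= d'.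
  move=> /standard_partN ac ad; rewrite -subr_ge0.
  have := standard_partD _ _ _ _ ad ac; rewrite subrr.
  by apply: standard_part_ge0; apply: qm0.
by move=> ac ad; apply/eqP; rewrite eq_le !(le a).
Qed.

(** [M] need not be closed under products, so [r^2 - a^2 = (r - a) (r + a)] is not usable directly.
    Multiplied by [2 r], it becomes [(a + r)^2 (r - a) + (r - a)^2 (a + r)], where each term is a
    square times an element of [M]. *)
Lemma standard_partX2_eq0 a : standard_part a 0 -> standard_part (a ^+ 2) 0.
Proof.
move=> a0 e e0; rewrite rmorph0 subr0 sub0r; split.
  by apply: qmD => //; [exact: qmX2|apply: qmC => //; exact: ltW].
have e'0 : 0 < Num.sqrt e by rewrite sqrtr_gt0.
have [] := a0 _ e'0; rewrite rmorph0 subr0 sub0r => h1 h2.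
rewrite -{1}(sqr_sqrtr (ltW e0)); set r := Num.sqrt e in e'0 h1 h2 *.
apply: (qmZI _ qM (2 * r)); first by lra.
have -> : iota (2 * r) * (- a ^+ 2 + iota (r ^+ 2))
  = (a + iota r) ^+ 2 * (- a + iota r) + (- a + iota r) ^+ 2 * (a + iota r) by ring.
by apply: qmD => //; apply: qmM2.
Qed.

Lemma standard_partX2 a c : standard_part a c -> standard_part (a ^+ 2) (c ^+ 2).
Proof.
move=> ac; have a0 : standard_part (a - iota c) 0.
  by rewrite -(subrr c); apply/standard_partD/standard_partN/standard_partC.
have -> : a ^+ 2 = (a - iota c) ^+ 2 + (iota (2 * c) * a - iota (c ^+ 2)) by ring.
rewrite [X in standard_part _ X](_ : _ = 0 + (2 * c * c - c ^+ 2)); last by ring.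
apply: standard_partD; first exact: standard_partX2_eq0.
apply: standard_partD; first exact: standard_partZ.
by apply: standard_partN; apply: standard_partC.
Qed.

(** Polarization reduces products to squares, and [standard_partX2] reduces squares to the
    infinitesimal case. *)
Lemma standard_partM a b c d :
  standard_part a c -> standard_part b d -> standard_part (a * b) (c * d).
Proof.
move=> ac bd.
have -> : c * d = 4^-1 * ((c + d) ^+ 2 - (c - d) ^+ 2) by field.
have -> : a * b = iota 4^-1 * ((a + b) ^+ 2 - (a - b) ^+ 2).
  transitivity (iota (4^-1 * 4) * (a * b)); last by ring.
  by rewrite mulVf ?pnatr_eq0 // rmorph1 mul1r.
apply/standard_partZ/standard_partD; first exact/standard_partX2/standard_partD.
exact/standard_partN/standard_partX2/standard_partD/standard_partN.
Qed.

(** The value is the supremum of the reals below [a], a set that is nonempty and bounded because [M]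
    is archimedean and proper. Totality of [M] supplies the upper estimate: a real that is not below
    [a] is above it. *)
Lemma standard_part_exists a : archimedean_module M -> exists c, standard_part a c.
Proof.
move=> arch; pose S := [set r | M (a - iota r)]%classic.
have [r1 Mr1] := arch (- a); have [r2 Mr2] := arch a.
have Sub r : S r -> r <= r2.
  rewrite /S /= => Mr; rewrite leNgt; apply/negP => lt2.
  apply/M1/(qm_negC _ qM (r - r2)); first lra.
  have -> : - iota (r - r2) = (a - iota r) + (iota r2 - a) by ring.
  exact: qmD.
have S0 : S (- r1) by rewrite /S /= rmorphN opprK addrC -[X in _ + X]opprK.
have supS : has_sup S by split; [exists (- r1)|exists r2 => r /Sub].
exists (sup S) => e e0; split.
  have [r Sr lt_r] := sup_adherent e0 supS.
  have -> : a - iota (sup S) + iota e = (a - iota r) + iota (r - (sup S - e)) by ring.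
  by apply: qmD => //; apply: qmC => //; lra.
have [|] := maximal_total (a - iota (sup S + e)) => [Se|].
  have : sup S + e <= sup S by apply: ub_le_sup => //; case: supS.
  by lra.
by rewrite opprB rmorphD addrAC.
Qed.

End Maximal.

(** If [f] is not in [M], then [M] with [- f] adjoined is still proper by [qm_of_adjoin_opp]. The
    standard part of a maximal extension is then a character that is nonnegative on [M] and on
    [- f], against the hypothesis. *)
Theorem archimedean_positivstellensatz M f :
  quadratic_module M -> archimedean_module M ->
  (forall phi : {rmorphism A -> R}, (forall c, phi (iota c) = c) ->
     (forall a, M a -> 0 <= phi a) -> 0 < phi f) ->
  M f.
Proof.
move=> qM archM posf; apply: contrapT => Mf.
have [//||N [qN MN N1 maxN]] :=
  @maximal_quadratic_module (adjoin M (- f)); first exact: qm_adjoin.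
  by move=> /(qm_of_adjoin_opp _ qM _ archM).
have archN : archimedean_module N.
  by move=> a; have [r Mr] := archM a; exists r; apply/MN/sub_adjoin.
have /choice[phi phiP] : forall a, exists c, standard_part N a c.
  by move=> a; apply: standard_part_exists.
have uniqN := standard_part_uniq _ qN N1.
have phiB : zmod_morphism phi.
  move=> a b; apply: uniqN (phiP _) _.
  exact: (standard_partD _ qN _ _ _ _ (phiP a) (standard_partN _ _ _ (phiP b))).
have phiM : monoid_morphism phi.
  split=> [|a b]; apply: uniqN (phiP _) _; last exact: standard_partM.
  by rewrite -(rmorph1 iota); apply: standard_partC.
pose phir : {rmorphism A -> R} := HB.pack phi
  (GRing.isZmodMorphism.Build A R phi phiB) (GRing.isMonoidMorphism.Build A R phi phiM).
have phiN a : N a -> 0 <= phi a by move=> Na; apply: standard_part_ge0 Na (phiP _).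
have /= := posf phir; rewrite ltNge => /(_ _ _)/negP; apply.
- by move=> c; apply: uniqN (phiP _) _; apply: standard_partC.
- by move=> a Ma; apply/phiN/MN/sub_adjoin.
- by rewrite -oppr_ge0 -[- phi f](raddfN phir); apply/phiN/MN/mem_adjoin.
Qed.

End QuadraticModules.

Arguments quadratic_module {A} M.
Arguments archimedean_module {R A} iota M.

(** * Characters and bounded elements of polynomial rings *)

Section MPolyModules.
Variable R : realType.

Lemma mpoly_alg_ind N (K : {mpoly R[N]} -> Prop) :
  (forall c, K c%:MP) -> (forall i, K 'X_i) ->
  (forall a b, K a -> K b -> K (a + b)) -> (forall a b, K a -> K b -> K (a * b)) ->
  forall a, K a.
Proof.
move=> KC KX KD KM; elim/mpolyind => [|c mn a _ _ Ka]; first by rewrite -mpolyC0.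
apply: (KD) => //; rewrite -mul_mpolyC; apply: (KM) => //; rewrite mpolyXE_id.
elim/big_ind: _ => [|b b' Kb Kb'|i _]; [by rewrite -mpolyC1|exact: KM|].
elim: (mn i) => [|k IH]; first by rewrite expr0 -mpolyC1.
by rewrite exprS; apply: KM.
Qed.

Lemma meval_sumX2 N (v : 'I_N -> R) :
  (\sum_(i < N) 'X_i ^+ 2 : {mpoly R[N]}).@[v] = \sum_(i < N) v i ^+ 2.
Proof.
by rewrite raddf_sum; apply: eq_bigr => i _ /=; rewrite rmorphXn /= mevalXU.
Qed.

(** Turns the abstract characters of the Positivstellensatz into points of real affine space. *)
Lemma rmorph_mpolyE N (phi : {rmorphism {mpoly R[N]} -> R}) :
  (forall c, phi c%:MP = c) -> forall a, phi a = a.@[fun i => phi 'X_i].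
Proof.
move=> phiC; elim/mpoly_alg_ind => [c|i|a b Ea Eb|a b Ea Eb].
- by rewrite phiC mevalC.
- by rewrite mevalXU.
- by rewrite rmorphD mevalD -Ea -Eb.
- by rewrite rmorphM mevalM -Ea -Eb.
Qed.

(** The elements bounded on both sides form a subring. It contains the constants, and it contains
    each variable because [1 - 'X_i ^+ 2] is the sphere element plus the other squares. *)
Lemma archimedean_mpoly N (M : set {mpoly R[N]}) : quadratic_module M ->
  M (1 - \sum_(i < N) 'X_i ^+ 2) -> archimedean_module (@mpolyC N R) M.
Proof.
move=> qM Msph; pose iota : {rmorphism R -> {mpoly R[N]}} := @mpolyC N R.
pose bdd a := exists r, [/\ 0 < r, M (iota r - a) & M (iota r + a)].
have bddN a : bdd a -> bdd (- a).
  by move=> [r [r0 M1 M2]]; exists r; rewrite opprK.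
have bddD a b : bdd a -> bdd b -> bdd (a + b).
  move=> [r [r0 M1 M2]] [r' [r'0 M1' M2']]; exists (r + r'); split; first lra.
    have -> : iota (r + r') - (a + b) = (iota r - a) + (iota r' - b) by ring.
    exact: qmD.
  have -> : iota (r + r') + (a + b) = (iota r + a) + (iota r' + b) by ring.
  exact: qmD.
have bddX2 a : bdd a -> bdd (a ^+ 2).
  move=> [r [r0 M1 M2]]; exists (r ^+ 2); split; first by rewrite exprn_gt0.
    apply: (qmZI _ _ iota _ qM (2 * r)); first lra.
    have -> : iota (2 * r) * (iota (r ^+ 2) - a ^+ 2) =
      (iota r - a) ^+ 2 * (iota r + a) + (iota r + a) ^+ 2 * (iota r - a) by ring.
    by apply: qmD => //; apply: qmM2.
  by apply: qmD => //; [apply: (qmC _ _ iota)|apply: qmX2]; rewrite ?sqr_ge0.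
have bddZI a c : 0 < c -> bdd (iota c * a) -> bdd a.
  move=> c0 [r [r0 M1 M2]]; exists (r / c).
  have e : iota r = iota c * iota (r / c) by rewrite -rmorphM mulrCA divff ?gt_eqF ?mulr1.
  split; first exact: divr_gt0.
    by apply: (qmZI _ _ iota _ qM c) => //; rewrite mulrBr -e.
  by apply: (qmZI _ _ iota _ qM c) => //; rewrite mulrDr -e.
have bdd_all a : bdd a.
  elim/mpoly_alg_ind: a => [c|i|//|a b Ba Bb].
  - exists (1 + `|c|); have := ler_norm c; have := ler_norm (- c).
    rewrite normrN => h1 h2; split; first by have := normr_ge0 c; lra.
      by rewrite -/(iota c) -rmorphB; apply: qmC => //; lra.
    by rewrite -/(iota c) -rmorphD; apply: qmC => //; lra.
  - have MX : M (1 - 'X_i ^+ 2).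
      rewrite (bigD1 i) //= opprD addrA in Msph.
      rewrite -[X in M X](subrK (\sum_(j < N | j != i) 'X_j ^+ 2)).
      apply: qmD => //; elim/big_ind: _ => [|x y Mx My|j _]; first exact: qm0.
        exact: qmD.
      exact: qmX2.
    exists 1; rewrite rmorph1; split=> //.
      apply: (qmZI _ _ iota _ qM 2); first lra.
      have -> : iota 2 * (1 - 'X_i) = (1 - 'X_i) ^+ 2 + (1 - 'X_i ^+ 2) by ring.
      by apply: qmD => //; apply: qmX2.
    apply: (qmZI _ _ iota _ qM 2); first lra.
    have -> : iota 2 * (1 + 'X_i) = (1 + 'X_i) ^+ 2 + (1 - 'X_i ^+ 2) by ring.
    by apply: qmD => //; apply: qmX2.
  (* Products are reached by polarization, since squares of bounded elements are bounded. *)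
  - apply: (bddZI _ 4); first lra.
    have -> : iota 4 * (a * b) = (a + b) ^+ 2 + - (a - b) ^+ 2 by ring.
    by apply/bddD/bddN/bddX2/bddD/bddN => //; apply/bddX2/bddD.
by move=> a; have [r [_ Mr _]] := bdd_all a; exists r.
Qed.

End MPolyModules.

(** * The quadratic module of the sphere *)

Section Certificates.
Variables (R : realType) (n m : nat) (ps : m.-tuple {mpoly R[n]}).
Implicit Types (f g : 'rV[R]_n -> R) (t : 'rV[R]_n) (s : R).

(** Stated for functions rather than polynomials, so that powers of [theta] and antipodal means can
    be treated. *)
Definition certificate f : Prop :=
  exists (L : finType) (q : L -> {mpoly R[n]}) (qk : 'I_m -> L -> {mpoly R[n]}),
    forall t, f t = \sum_(l : L) (q l).@[t 0] ^+ 2 +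
      \sum_(k < m) \sum_(l : L) (tnth ps k).@[t 0] * (qk k l).@[t 0] ^+ 2.

Lemma certificate_ext f g : f =1 g -> certificate f -> certificate g.
Proof. by move=> /funext ->. Qed.

Lemma certificateX2 (a : {mpoly R[n]}) : certificate (fun t => a.@[t 0] ^+ 2).
Proof.
exists unit, (fun=> a), (fun _ _ => 0) => t.
rewrite (big_pred1 tt) => [|[]//]; rewrite big1 ?addr0 // => k _.
by rewrite big1 // => l _; rewrite meval0 expr0n mulr0.
Qed.

Lemma certificate_gen (a : {mpoly R[n]}) k :
  certificate (fun t => (tnth ps k).@[t 0] * a.@[t 0] ^+ 2).
Proof.
exists unit, (fun=> 0), (fun k' _ => if k' == k then a else 0) => t.
rewrite big1 => [|l _]; last by rewrite meval0 expr0n.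
rewrite add0r (bigD1 k) //= (big_pred1 tt) => [|[]//].
rewrite eqxx big1 ?addr0 // => k' /negPf ->.
by rewrite big1 // => l _; rewrite meval0 expr0n mulr0.
Qed.

Lemma certificateD f g :
  certificate f -> certificate g -> certificate (fun t => f t + g t).
Proof.
move=> [L [q [qk fE]]] [L' [q' [qk' gE]]].
exists (L + L')%type, (fun l => match l with inl l => q l | inr l => q' l end),
  (fun k l => match l with inl l => qk k l | inr l => qk' k l end) => t.
rewrite fE gE big_sumType /= addrACA; congr (_ + _).
by rewrite -big_split /=; apply: eq_bigr => k _; rewrite big_sumType.
Qed.

Lemma certificateM2 (a : {mpoly R[n]}) f :
  certificate f -> certificate (fun t => a.@[t 0] ^+ 2 * f t).
Proof.
move=> [L [q [qk fE]]].
exists L, (fun l => a * q l), (fun k l => a * qk k l) => t.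
rewrite fE mulrDr mulr_sumr; congr (_ + _).
  by apply: eq_bigr => l _; rewrite mevalM exprMn.
rewrite mulr_sumr; apply: eq_bigr => k _; rewrite mulr_sumr; apply: eq_bigr => l _.
by rewrite mevalM exprMn mulrCA.
Qed.

Definition weight : {mpoly R[n]} := 1 + \sum_(i < n) 'X_i ^+ 2.

Lemma weightE t : weight.@[t 0] = 1 + \sum_(i < n) t 0 i ^+ 2.
Proof. by rewrite mevalD meval1 meval_sumX2. Qed.

Lemma weight_gt0 t : 0 < weight.@[t 0].
Proof. by rewrite weightE ltr_pwDl // sumr_ge0 // => i _; rewrite sqr_ge0. Qed.

Lemma thetaE t : theta t = weight.@[t 0]^-1. Proof. by rewrite weightE. Qed.

Lemma theta_gt0 t : 0 < theta t. Proof. by rewrite thetaE invr_gt0 weight_gt0. Qed.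

Lemma weight_theta t : weight.@[t 0] * theta t = 1.
Proof. by rewrite thetaE divff // gt_eqF ?weight_gt0. Qed.

(** [weight] is itself a sum of squares, so its odd powers are admissible multipliers too. *)
Lemma certificate_weight f :
  certificate f -> certificate (fun t => weight.@[t 0] * f t).
Proof.
move=> cf; apply: (@certificate_ext (fun t => f t + \sum_(i < n) t 0 i ^+ 2 * f t)).
  by move=> t; rewrite weightE mulrDl mul1r mulr_suml.
elim: (index_enum _) => [|i r IH].
  by apply: certificate_ext cf => t; rewrite big_nil addr0.
apply: certificate_ext (certificateD _ _ (certificateM2 'X_i _ cf) IH) => t.
by rewrite big_cons mevalXU addrCA.
Qed.

(** The conclusion with its factor [theta t ^+ (2 * b)] cleared. The even exponent makes the
    multiplier a square, so two such certificates can be brought to a common exponent. *)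
Definition weighted_certificate f : Prop :=
  exists b, certificate (fun t => weight.@[t 0] ^+ (2 * b)%N * f t).

Lemma weighted_ext f g : f =1 g -> weighted_certificate f -> weighted_certificate g.
Proof. by move=> /funext ->. Qed.

Lemma weighted_certificateI f : certificate f -> weighted_certificate f.
Proof. by move=> cf; exists 0; apply: certificate_ext cf => t; rewrite expr0 mul1r. Qed.

Lemma weightedD f g : weighted_certificate f -> weighted_certificate g ->
  weighted_certificate (fun t => f t + g t).
Proof.
move=> [b cf] [c cg]; exists (b + c)%N.
apply: certificate_ext (certificateD _ _ (certificateM2 (weight ^+ c) _ cf)
  (certificateM2 (weight ^+ b) _ cg)) => t.
by rewrite !rmorphXn /= !(mulnC 2) mulnDl exprD !exprM; ring.
Qed.

Lemma weighted_theta k f :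
  weighted_certificate f -> weighted_certificate (fun t => theta t ^+ k * f t).
Proof.
elim: k => [|k IH] cf; first by apply: weighted_ext cf => t; rewrite mul1r.
(* Passing to [b.+1] adds two factors [weight]: one cancels the new [theta t], the other is absorbed
   by [certificate_weight]. *)
have [b cb] := IH cf; exists b.+1.
apply: certificate_ext (certificate_weight _ cb) => t.
rewrite mulnS exprD [theta t ^+ k.+1]exprS -[RHS]mulrA.
transitivity (weight.@[t 0] * (weight.@[t 0] * theta t) *
  (weight.@[t 0] ^+ (2 * b)%N * (theta t ^+ k * f t))); last by ring.
by rewrite weight_theta mulr1.
Qed.

Lemma weighted_thetaI k f :
  weighted_certificate (fun t => theta t ^+ k * f t) -> weighted_certificate f.
Proof.
elim: k => [|k IH]; first by apply: weighted_ext => t; rewrite mul1r.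
move=> [b cb]; apply: IH; exists b; apply: certificate_ext (certificate_weight _ cb) => t.
transitivity (weight.@[t 0] * theta t * (weight.@[t 0] ^+ (2 * b)%N * (theta t ^+ k * f t))).
  by rewrite exprS; ring.
by rewrite weight_theta mul1r.
Qed.

(* For [s ^+ 2 = theta t], the points [s (1, t)] and [- s (1, t)] are the
   antipodal points of the unit sphere representing [t] in projective space. *)
Definition cone_pt s t (i : 'I_n.+1) : R := s * oapp (t 0) 1 (unlift ord0 i).

Lemma cone_pt0 s t : cone_pt s t ord0 = s.
Proof. by rewrite /cone_pt unlift_none mulr1. Qed.

Lemma cone_ptS s t i : cone_pt s t (lift ord0 i) = s * t 0 i.
Proof. by rewrite /cone_pt liftK. Qed.

Lemma cone_ptP (x : 'I_n.+1 -> R) : x ord0 != 0 ->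
  x =1 cone_pt (x ord0) (\row_i (x (lift ord0 i) / x ord0)).
Proof.
move=> x0 i; have [j ->|->] := unliftP ord0 i; last by rewrite cone_pt0.
by rewrite cone_ptS mxE mulrC divfK.
Qed.

(** Substituting [theta t] for [s ^+ 2] splits the value into an even part [a] and an odd part
    [s b]; powers of [weight] bring all terms to one common power of [theta]. *)
Lemma meval_cone_decomp (F : {mpoly R[n.+1]}) : exists (a b : {mpoly R[n]}) k,
  forall t s, s ^+ 2 = theta t ->
    F.@[cone_pt s t] = theta t ^+ k * (a.@[t 0] + s * b.@[t 0]).
Proof.
elim/mpoly_alg_ind: F => [c|i|F F' [a [b [k E]]] [a' [b' [k' E']]]|
                        F F' [a [b [k E]]] [a' [b' [k' E']]]].
- by exists c%:MP, 0, 0 => t s _; rewrite mul1r meval0 mulr0 addr0 !mevalC.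
- exists 0, (oapp (fun j => 'X_j) 1 (unlift ord0 i)), 0 => t s _.
  rewrite mul1r mevalXU meval0 add0r /cone_pt; congr (_ * _).
  by case: (unlift _ _) => [j|] /=; rewrite ?mevalXU ?meval1.
- exists (weight ^+ k' * a + weight ^+ k * a'),
    (weight ^+ k' * b + weight ^+ k * b'), (k + k')%N => t s st.
  rewrite mevalD (E _ _ st) (E' _ _ st) !mevalD !mevalM !rmorphXn /= exprD.
  have w1 l : theta t ^+ l * weight.@[t 0] ^+ l = 1.
    by rewrite -exprMn mulrC weight_theta expr1n.
  transitivity (theta t ^+ k * (theta t ^+ k' * weight.@[t 0] ^+ k') *
      (a.@[t 0] + s * b.@[t 0]) + theta t ^+ k' *
      (theta t ^+ k * weight.@[t 0] ^+ k) * (a'.@[t 0] + s * b'.@[t 0])).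
    by rewrite !w1 !mulr1.
  by ring.
- exists (weight * a * a' + b * b'), (weight * (a * b' + b * a')), (k + k').+1 => t s st.
  rewrite mevalM (E _ _ st) (E' _ _ st) mevalD !mevalM.
  rewrite (mevalD _ (a * b')) !mevalM exprS exprD.
  transitivity (theta t ^+ k * theta t ^+ k' * (a.@[t 0] * a'.@[t 0]
     + s ^+ 2 * (b.@[t 0] * b'.@[t 0])
     + s * (a.@[t 0] * b'.@[t 0] + b.@[t 0] * a'.@[t 0]))); first by ring.
  transitivity (theta t ^+ k * theta t ^+ k' *
     (weight.@[t 0] * theta t * (a.@[t 0] * a'.@[t 0])
     + theta t * (b.@[t 0] * b'.@[t 0])
     + s * (weight.@[t 0] * theta t) * (a.@[t 0] * b'.@[t 0] + b.@[t 0] * a'.@[t 0]))).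
    by rewrite weight_theta st mul1r mulr1.
  by ring.
Qed.

(** * Averaging over antipodal points *)

Definition antipodal_mean (F : {mpoly R[n.+1]}) t : R :=
  (F.@[cone_pt (Num.sqrt (theta t)) t] + F.@[cone_pt (- Num.sqrt (theta t)) t]) / 2.

Lemma sqrt_theta t : Num.sqrt (theta t) ^+ 2 = theta t.
Proof. by rewrite sqr_sqrtr // ltW // theta_gt0. Qed.

(** In [(a + s b)^2] the mean over [s] and [- s] removes the cross term and leaves
    [a^2 + s^2 b^2]. *)
Lemma antipodal_meanX2 (Q : {mpoly R[n.+1]}) : exists (a b : {mpoly R[n]}) k,
  forall t, antipodal_mean (Q ^+ 2) t =
    theta t ^+ (2 * k)%N * (a.@[t 0] ^+ 2 + theta t ^+ 1 * b.@[t 0] ^+ 2).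
Proof.
have [a [b [k QE]]] := meval_cone_decomp Q; exists a, b, k => t.
rewrite /antipodal_mean !rmorphXn /= !QE ?sqrrN ?sqrt_theta //.
rewrite mulnC exprM expr1; move: (theta t ^+ k) (sqrt_theta t) => u.
by move: (Num.sqrt _) => s <-; field.
Qed.

Lemma antipodal_mean_even (F Q : {mpoly R[n.+1]}) f :
  (forall t s, s ^+ 2 = theta t -> F.@[cone_pt s t] = f t) ->
  antipodal_mean (F * Q) =1 (fun t => f t * antipodal_mean Q t).
Proof.
move=> FE t; rewrite /antipodal_mean !mevalM !FE ?sqrrN ?sqrt_theta //.
by field.
Qed.

(* Quantifying over the squares [Q ^+ 2] makes this class stable under
   multiplication by squares, which taking the mean alone would not. *)
Definition sphere_module : set {mpoly R[n.+1]} :=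
  [set F | forall Q, weighted_certificate (antipodal_mean (F * Q ^+ 2))]%classic.

(** A factor with equal values at antipodal points leaves the mean, so only the squares produced by
    [antipodal_meanX2] have to be multiplied by [f]. *)
Lemma sphere_module_even (F : {mpoly R[n.+1]}) f :
  (forall t s, s ^+ 2 = theta t -> F.@[cone_pt s t] = f t) ->
  (forall a : {mpoly R[n]}, weighted_certificate (fun t => f t * a.@[t 0] ^+ 2)) ->
  sphere_module F.
Proof.
move=> FE fcert Q; have [a [b [k QE]]] := antipodal_meanX2 Q.
apply: weighted_ext (weighted_theta (2 * k)%N _
  (weightedD _ _ (fcert a) (weighted_theta 1 _ (fcert b)))) => t.
by rewrite (antipodal_mean_even _ _ _ FE) QE; ring.
Qed.

Lemma quadratic_sphere_module : quadratic_module sphere_module.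
Proof.
split=> [|F G MF MG Q|F G MG Q].
- apply: (sphere_module_even _ (fun=> 1)) => [t s _|a]; first by rewrite meval1.
  by apply/weighted_certificateI/(certificate_ext _ _ _ (certificateX2 a)) => t;
     rewrite mul1r.
- apply: weighted_ext (weightedD _ _ (MF Q) (MG Q)) => t.
  by rewrite /antipodal_mean (mulrDl F G) !mevalD; field.
- by rewrite mulrAC -exprMn mulrC; apply: MG.
Qed.

Lemma sum_cone_ptX2 s t : s ^+ 2 = theta t -> \sum_i cone_pt s t i ^+ 2 = 1.
Proof.
move=> st; rewrite big_ord_recl cone_pt0.
under eq_bigr do rewrite cone_ptS exprMn.
by rewrite -mulr_sumr -[X in X + _]mulr1 -mulrDr st mulrC -weightE weight_theta.
Qed.

(** Cone points lie on the unit sphere, so the mean vanishes. Allowing [c] of either sign forces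
    characters nonnegative on the module to lie exactly on the sphere. *)
Lemma sphere_module_norm c : sphere_module (c *: (1 - \sum_i 'X_i ^+ 2)).
Proof.
apply: (sphere_module_even _ (fun=> 0)) => [t s st|a]; last first.
  apply/weighted_certificateI/(certificate_ext _ _ _ (certificateX2 0)) => t.
  by rewrite meval0 expr0n mul0r.
by rewrite mevalZ mevalB meval1 meval_sumX2 sum_cone_ptX2 // subrr mulr0.
Qed.

Lemma sphere_module_gen (F : {mpoly R[n.+1]}) k e :
  (forall t s, F.@[cone_pt s t] = s ^+ (2 * e)%N * (tnth ps k).@[t 0]) ->
  sphere_module F.
Proof.
move=> FE; apply: (sphere_module_even _ (fun t => theta t ^+ e * (tnth ps k).@[t 0])).
  by move=> t s st; rewrite FE exprM st.
move=> a; apply: weighted_ext (weighted_theta e _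
  (weighted_certificateI _ (certificate_gen a k))) => t.
by rewrite mulrA.
Qed.

(** The test square [1] suffices: the mean of [F] is [theta t ^+ e] times [f], and the power of
    [theta] can be removed. *)
Lemma sphere_module_cert (F : {mpoly R[n.+1]}) (f : {mpoly R[n]}) e :
  (forall t s, s != 0 -> F.@[cone_pt s t] = s ^+ (2 * e)%N * f.@[t 0]) ->
  sphere_module F -> weighted_certificate (fun t => f.@[t 0]).
Proof.
move=> FE /(_ 1); rewrite expr1n mulr1 => cF; apply: (weighted_thetaI e).
apply: weighted_ext cF => t.
have s0 : Num.sqrt (theta t) != 0 by rewrite gt_eqF // sqrtr_gt0 theta_gt0.
rewrite /antipodal_mean !FE ?oppr_eq0 // !exprM sqrrN sqrt_theta.
by field.
Qed.

End Certificates.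

Lemma homogenization_cone (R : realType) n (g : {mpoly R[n]}) G s t :
  is_homogenization g G -> s != 0 ->
  G.@[cone_pt R n s t] = s ^+ (msize g).-1 * g.@[t 0].
Proof.
move=> [_ GE] s0; have xE : (\row_i cone_pt R n s t i) 0 =1 cone_pt R n s t.
  by move=> i; rewrite mxE.
rewrite -(meval_eq _ xE) GE xE cone_pt0 //; congr (_ * _).
by apply: meval_eq => i; rewrite xE cone_ptS mulrC mulKf.
Qed.

(** * Homogenization *)

Lemma homogenization_sum (R : realType) n (g0 g1 : {mpoly R[n]}) G1 :
  (msize g0 < msize g1)%N -> is_homogenization g1 G1 ->
  exists P : {mpoly R[n.+1]},
    (forall t s, s != 0 ->
       P.@[cone_pt R n s t] = s ^+ (msize g1).-1 * (g0 + g1).@[t 0]) /\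
    (forall x : 'I_n.+1 -> R, x ord0 = 0 -> P.@[x] = G1.@[x]).
Proof.
(* The case [g0 = 0] is separate: as [msize 0 = 0], the strict inequality between predecessors fails
   when [g1] is a nonzero constant. *)
move=> ltg hG1; have [->|g0n0] := eqVneq g0 0.
  exists G1; split=> // t s s0; rewrite add0r; exact: homogenization_cone.
have [G0 hG0] := is_homogenization_exists g0.
have lt01 : ((msize g0).-1 < (msize g1).-1)%N.
  by move: g0n0 ltg; rewrite -msize_poly_eq0; case: (msize g0) (msize g1) => [|u] // [].
(* The exponent of ['X_ord0] is positive, so the contribution of [g0] vanishes on the hyperplane at
   infinity. *)
exists ('X_ord0 ^+ ((msize g1).-1 - (msize g0).-1) * G0 + G1); split=> [t s s0|x x0].
  rewrite !mevalD mevalM rmorphXn /= mevalXU cone_pt0.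
  rewrite (homogenization_cone _ _ _ _ _ _ hG0) // (homogenization_cone _ _ _ _ _ _ hG1) //.
  rewrite mulrA -exprD subnK ?mulrDr //.
  exact: ltnW.
by rewrite mevalD mevalM rmorphXn /= mevalXU x0 expr0n subn_eq0 leqNgt lt01 mul0r add0r.
Qed.

(** Antipodal values differ by the factor [(-1)^d], so both can be positive only for even [d]. *)
Lemma even_homogenization (R : realType) n (g : {mpoly R[n]}) G s t :
  is_homogenization g G -> s != 0 -> 0 < G.@[cone_pt R n s t] ->
  0 < G.@[cone_pt R n (- s) t] -> ~~ odd (msize g).-1.
Proof.
move=> hG s0; rewrite !(homogenization_cone _ _ _ _ _ _ hG) ?oppr_eq0 // exprNn.
move: (msize g).-1 => d G_gt0; case/boolP: (odd d) => // dodd.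
by rewrite -signr_odd dodd expr1 mulN1r mulNr oppr_gt0 ltNge ltW.
Qed.

Lemma even_homogenization_exists (R : realType) n (g : {mpoly R[n]}) :
  exists (e : nat) (F : {mpoly R[n.+1]}),
    forall t s, F.@[cone_pt R n s t] = s ^+ (2 * e)%N * g.@[t 0].
Proof.
have [G hG] := is_homogenization_exists g; set d := (msize g).-1.
(* The exponent [d.+2] has the parity of [d] and is positive even for [d = 0], so both sides vanish
   at [s = 0]. *)
exists d.+1, ('X_ord0 ^+ d.+2 * G) => t s.
rewrite mevalM rmorphXn /= mevalXU cone_pt0.
have [->|s0] := eqVneq s 0; first by rewrite !expr0n mulnS !mul0r.
rewrite (homogenization_cone _ _ _ _ _ _ hG) // -/d mulrA -exprD.
by congr (_ ^+ _ * _); rewrite mul2n -addnn addSnnS.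
Qed.

(** * Positivity on the sphere and descent to affine space *)

Theorem corollary4p4 (R : realType) (n : nat) (hn : (0 < n)%N)
    (m : nat) (ps : m.-tuple {mpoly R[n]})
    (g1 g0 : {mpoly R[n]}) (hdeg : (msize g0 < msize g1)%N)
    (G1 : {mpoly R[n.+1]}) (hG1 : is_homogenization g1 G1)
    (hG1pos : forall x : 'rV[R]_n.+1, x != 0 -> 0 < G1.@[x 0])
    (p : {mpoly R[n]}) (hp : p = g0 + g1)
    (hpos : forall t : 'rV[R]_n,
        (forall k : 'I_m, 0 <= (tnth ps k).@[t 0]) -> 0 < p.@[t 0]) :
  exists (b : nat) (L : finType) (q : L -> {mpoly R[n]})
         (qk : 'I_m -> L -> {mpoly R[n]}),
    forall t : 'rV[R]_n,
      p.@[t 0] = theta t ^+ (2 * b) *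
        (\sum_(l : L) (q l).@[t 0] ^+ 2 +
         \sum_(k < m) \sum_(l : L) (tnth ps k).@[t 0] * (qk k l).@[t 0] ^+ 2).
Proof.
have [P [Pcone Pinf]] := homogenization_sum _ _ _ _ _ hdeg hG1.
have cone_n0 s t (s0 : s != 0) : 0 < G1.@[cone_pt R n s t].
  have xE : (\row_i cone_pt R n s t i) 0 =1 cone_pt R n s t by move=> i; rewrite mxE.
  rewrite -(meval_eq _ xE); apply: hG1pos; apply: contra_neq s0 => x0.
  by rewrite -(cone_pt0 R n s t) -xE x0 mxE.
have even_d : ~~ odd (msize g1).-1.
  by apply: (even_homogenization _ _ _ _ 1 0 hG1); rewrite ?cone_n0 ?oppr_eq0 ?oner_eq0.
have {even_d}dE : (msize g1).-1 = (2 * (msize g1).-1./2)%N.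
  by rewrite mul2n even_halfK.
rewrite -hp dE in Pcone; move: (_./2) Pcone => e Pcone {dE}.
have MP : sphere_module R n m ps P.
  apply: (@archimedean_positivstellensatz _ _ (@mpolyC n.+1 R)).
  - exact: quadratic_sphere_module.
  - apply: archimedean_mpoly; first exact: quadratic_sphere_module.
    by rewrite -[X in sphere_module _ _ _ _ X]scale1r; apply: sphere_module_norm.
  - move=> phi phiC phi_ge0; have phiE := rmorph_mpolyE _ _ _ phiC.
    set x := fun i => phi 'X_i in phiE.
    have sph : \sum_i x i ^+ 2 = 1.
      have h c : 0 <= c * (1 - \sum_i x i ^+ 2).
        have := phi_ge0 _ (sphere_module_norm R n m ps c).
        by rewrite phiE mevalZ mevalB meval1 meval_sumX2.
      by have := h 1; have := h (-1); lra.
    rewrite phiE; have [x0|x0] := eqVneq (x ord0) 0.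
      rewrite Pinf //; have xE : (\row_i x i) 0 =1 x by move=> i; rewrite mxE.
      rewrite -(meval_eq _ xE); apply: hG1pos; apply/eqP => rx0.
      have := sph; rewrite big1 => [/esym/eqP|i _]; first by rewrite oner_eq0.
      by rewrite -xE rx0 mxE expr0n.
    (* Off infinity the point is [x ord0] times [(1, t)]; the even powers of [x ord0] are positive,
       so signs on the sphere agree with signs at [t]. *)
    have xE := cone_ptP _ _ _ x0; rewrite (meval_eq _ xE) Pcone //.
    set t := \row_i _ in xE *.
    have even_gt0 d : 0 < x ord0 ^+ (2 * d)%N by rewrite exprM exprn_gt0 // exprn_even_gt0.
    rewrite pmulr_rgt0 //; apply: hpos => k.
    have [d [F FE]] := even_homogenization_exists _ _ (tnth ps k).
    have := phi_ge0 _ (sphere_module_gen _ _ _ _ _ _ _ FE).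
    by rewrite phiE (meval_eq _ xE) FE pmulr_rge0.
have [b [L [q [qk pE]]]] := sphere_module_cert _ _ _ _ _ _ _ (fun t s => Pcone t s) MP.
exists b, L, q, qk => t; rewrite -pE mulrA -exprMn mulrC.
by rewrite [theta t * _]mulrC weight_theta expr1n mulr1.
Qed.
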